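(* Suppose player $A$'s payoffs lie in $[0,H]$. There exists an algorithm that, given the game, a finite memory length $m\ge1$, a memory-limited count-based learning rule $f_m$ of the opponent and the horizon $T$, guarantees player $A$ an expected cumulative payoff of at least $\mathrm{OPT}-O(k_A^mH)$ against $f_m$, and which runs in $O\big(k_A^{2m+1}+k_A^m(m+k_Ak_B)\big)$ time. Here $\mathrm{OPT}$ is the maximum expected cumulative payoff of player $A$ over $T$ rounds against $f_m$, and the constants hidden in $O(\cdot)$ are absolute.
   Context: Setting. A two-player normal-form game is repeated for $T$ rounds. Player $A$ (the optimizer) has actions $\mathcal{A}=\{a_1,\dots,a_{k_A}\}$, player $B$ (the opponent) has actions $\mathcal{B}=\{b_1,\dots,b_{k_B}\}$, with utilities $u^A,u^B:\mathcal{A}\times\mathcal{B}\to\mathbb{R}$. For $a\in\mathcal{A}$ and $\beta\in\Delta(\mathcal{B})$ (mixed actions of $B$), $\bar u^A(a,\beta)=\sum_{j=1}^{k_B}\beta(b_j)u^A(a,b_j)$. A memory-limited count-based learning rule $f_m$ with memory $m\ge1$ maps count vectors $(c_1,\dots,c_{k_A})\in\mathbb{N}^{k_A}$ with $\sum_ic_i\le m$ to $\Delta(\mathcal{B})$: in round $t$, player $B$ plays $f_m(c_1,\dots,c_{k_A})$, where $c_i$ is the number of times $A$ played $a_i$ in the last $\min(m,t-1)$ rounds. For a sequence of at most $m$ actions, $f_m([x_1,\dots,x_j])$ means $f_m$ applied to the counts of the listed actions. The expected cumulative payoff of $x_1,\dots,x_T\in\mathcal{A}$ is $\sum_{t=1}^T\bar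 u^A(x_t,f_m([x_{\max(1,t-m)},\dots,x_{t-1}]))$, and $\mathrm{OPT}$ is its maximum over $\mathcal{A}^T$. Computational convention: given a count vector, the output of $f_m$ can be computed in $O(k_Ak_B)$ time; arithmetic operations take unit time. The algorithm outputs a finite cycle of actions which player $A$ repeats until round $T$ (the running time is that of computing the cycle). *)

(* Defs.v *)
From mathcomp Require Import all_boot all_order all_algebra.
From mathcomp Require Import boolp classical_sets reals.

Set Implicit Arguments.
Unset Strict Implicit.
Unset Printing Implicit Defensive.

Import Order.TTheory GRing.Theory Num.Theory.
Local Open Scope ring_scope.

(** * The repeated game *)

Definition utility (R : realType) (kA kB : nat) := 'I_kA -> 'I_kB -> R.

Definition is_mixed (R : realType) (k : nat) (beta : 'I_k -> R) : Prop :=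
  (forall j, 0 <= beta j) /\ \sum_(j < k) beta j = 1.

Definition mixed_payoff (R : realType) (kA kB : nat) (u : utility R kA kB)
    (a : 'I_kA) (beta : 'I_kB -> R) : R :=
  \sum_(j < kB) beta j * u a j.

Definition counts (kA : nat) (s : seq 'I_kA) : {ffun 'I_kA -> nat} :=
  [ffun a => count_mem a s].

(* A count-based rule is represented by a total function; only its values on
   count vectors of total at most m matter: [is_rule m f] constrains only
   these, and neither the payoffs nor the machine below can see the others. *)
Definition count_rule (R : realType) (kA kB : nat) :=
  {ffun 'I_kA -> nat} -> 'I_kB -> R.

Definition is_rule (R : realType) (kA kB m : nat) (f : count_rule R kA kB) :
    Prop :=
  forall c : {ffun 'I_kA -> nat},
    (\sum_(a < kA) c a <= m)%N -> is_mixed (f c).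

(* Rounds are numbered from 0: before round t the actions in positions
   0, ..., t - 1 have been played, and the last minn m t of them are those in
   positions t - m, ..., t - 1 (truncated subtraction). *)
Definition recent (X : Type) (m t : nat) (s : seq X) : seq X :=
  drop (t - m) (take t s).

Definition payoff (R : realType) (kA kB : nat) (u : utility R kA kB) (m : nat)
    (f : count_rule R kA kB) (T : nat) (x : T.-tuple 'I_kA) : R :=
  \sum_(t < T) mixed_payoff u (tnth x t) (f (counts (recent m t x))).

(* The supremum is a maximum when there is at least one action, see
   [opt_max]. *)
Definition opt (R : realType) (kA kB : nat) (u : utility R kA kB) (m : nat)
    (f : count_rule R kA kB) (T : nat) : R :=
  sup [set payoff u m f x | x in [set: T.-tuple 'I_kA]].

Lemma opt_max (R : realType) (kA kB : nat) (u : utility R kA kB) (m : nat)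
    (f : count_rule R kA kB) (T : nat) : (0 < kA)%N ->
  (exists x : T.-tuple 'I_kA, payoff u m f x = opt u m f T) /\
  (forall x : T.-tuple 'I_kA, payoff u m f x <= opt u m f T).
Proof.
move=> kA_gt0; pose x0 := [tuple of nseq T (Ordinal kA_gt0)].
case: (@arg_maxP _ _ _ x0 xpredT (@payoff R kA kB u m f T) isT) => xm _ xmP.
have ubP : ubound [set payoff u m f x | x in [set: T.-tuple 'I_kA]]
    (payoff u m f xm) by move=> _ [x _ <-]; apply: xmP.
have optE : payoff u m f xm = opt u m f T.
  apply/le_anti/andP; split.
    by apply: ub_le_sup; [exists (payoff u m f xm) | exists xm].
  by apply: ge_sup => //; exists (payoff u m f xm), xm.
by split=> [|x]; [exists xm | rewrite -optE; apply: xmP].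
Qed.

(* Repeating a nonempty cycle of actions for T rounds. *)
Definition repeat_cycle (kA L : nat) (c : L.+1.-tuple 'I_kA) (T : nat) :
    T.-tuple 'I_kA :=
  [tuple tnth c (inord (t %% L.+1)) | t < T].

(** * The model of computation: a real RAM with oracle access to the rule

   Programs are structured (while-programs) and refer to finitely many integer
   and real registers and arrays.  Arrays are unbounded and random access.
   Integer operations are those on nat (truncated subtraction; Euclidean
   quotient and remainder); reals support field operations and comparisons,
   and integers can be cast to reals, but no operation goes from reals back to
   integers. *)

Inductive iop := IAdd | ISub | IMul | IDiv | IMod.

Inductive iexpr :=
  | IConst of nat
  | IVar of nat
  | IGet of nat & iexpr
  | IOp of iop & iexpr & iexpr.

Inductive rop := RAdd | RSub | RMul | RDiv.

Inductive rexpr :=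
  | RCast of iexpr
  | RVar of nat
  | RGet of nat & iexpr
  | ROp of rop & rexpr & rexpr.

Inductive bexpr :=
  | BIle of iexpr & iexpr
  | BRle of rexpr & rexpr
  | BNot of bexpr
  | BAnd of bexpr & bexpr.

(* [Query a b] applies the rule to the count vector in integer array a and
   writes the answer to real array b. *)
Inductive cmd :=
  | Skip
  | Seq of cmd & cmd
  | ISet of nat & iexpr
  | IPut of nat & iexpr & iexpr
  | RSet of nat & rexpr
  | RPut of nat & iexpr & rexpr
  | If of bexpr & cmd & cmd
  | While of bexpr & cmd
  | Query of nat & nat.

Record state (R : realType) := State {
  ivar : nat -> nat;
  iarr : nat -> nat -> nat;
  rvar : nat -> R;
  rarr : nat -> nat -> R
}.

Definition upd (V : Type) (g : nat -> V) (x : nat) (v : V) : nat -> V :=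
  fun y => if y == x then v else g y.

Definition iop_eval (o : iop) : nat -> nat -> nat :=
  match o with
  | IAdd => addn | ISub => subn | IMul => muln | IDiv => divn | IMod => modn
  end.

Fixpoint ieval (R : realType) (s : state R) (e : iexpr) : nat :=
  match e with
  | IConst n => n
  | IVar x => ivar s x
  | IGet a e1 => iarr s a (ieval s e1)
  | IOp o e1 e2 => iop_eval o (ieval s e1) (ieval s e2)
  end.

Definition rop_eval (R : realType) (o : rop) (x y : R) : R :=
  match o with
  | RAdd => x + y | RSub => x - y | RMul => x * y | RDiv => x / y
  end.

Fixpoint reval (R : realType) (s : state R) (e : rexpr) : R :=
  match e with
  | RCast e1 => (ieval s e1)%:R
  | RVar x => rvar s x
  | RGet a e1 => rarr s a (ieval s e1)
  | ROp o e1 e2 => rop_eval o (reval s e1) (reval s e2)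
  end.

Fixpoint beval (R : realType) (s : state R) (b : bexpr) : bool :=
  match b with
  | BIle e1 e2 => (ieval s e1 <= ieval s e2)%N
  | BRle e1 e2 => reval s e1 <= reval s e2
  | BNot b1 => ~~ beval s b1
  | BAnd b1 b2 => beval s b1 && beval s b2
  end.

Fixpoint icost (e : iexpr) : nat :=
  match e with
  | IConst _ | IVar _ => 1
  | IGet _ e1 => (icost e1).+1
  | IOp _ e1 e2 => (icost e1 + icost e2).+1
  end.

Fixpoint rcost (e : rexpr) : nat :=
  match e with
  | RCast e1 => (icost e1).+1
  | RVar _ => 1
  | RGet _ e1 => (icost e1).+1
  | ROp _ e1 e2 => (rcost e1 + rcost e2).+1
  end.

Fixpoint bcost (b : bexpr) : nat :=
  match b with
  | BIle e1 e2 => (icost e1 + icost e2).+1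
  | BRle e1 e2 => (rcost e1 + rcost e2).+1
  | BNot b1 => (bcost b1).+1
  | BAnd b1 b2 => (bcost b1 + bcost b2).+1
  end.

Definition set_ivar (R : realType) (s : state R) (x v : nat) : state R :=
  State (upd (ivar s) x v) (iarr s) (rvar s) (rarr s).

Definition set_iarr (R : realType) (s : state R) (a i v : nat) : state R :=
  State (ivar s) (upd (iarr s) a (upd (iarr s a) i v)) (rvar s) (rarr s).

Definition set_rvar (R : realType) (s : state R) (x : nat) (v : R) : state R :=
  State (ivar s) (iarr s) (upd (rvar s) x v) (rarr s).

Definition set_rarr (R : realType) (s : state R) (a i : nat) (v : R) :
    state R :=
  State (ivar s) (iarr s) (rvar s) (upd (rarr s) a (upd (rarr s a) i v)).

Definition read_counts (R : realType) (kA : nat) (s : state R) (a : nat) :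
    {ffun 'I_kA -> nat} :=
  [ffun i : 'I_kA => iarr s a i].

Definition write_mixed (R : realType) (kB : nat) (s : state R) (a : nat)
    (beta : 'I_kB -> R) : state R :=
  State (ivar s) (iarr s) (rvar s)
    (upd (rarr s) a
       (fun i => if insub i is Some j then beta j else rarr s a i)).

(* [exec m f p s t s']: from state s, the program p halts in state s' after t
   time units.  A query costs kA * kB (plus one) and has no semantics on count
   vectors of total larger than m. *)
Inductive exec (R : realType) (kA kB m : nat) (f : count_rule R kA kB) :
    cmd -> state R -> nat -> state R -> Prop :=
  | ExecSkip s : exec m f Skip s 1 s
  | ExecSeq p q s t1 s1 t2 s2 :
      exec m f p s t1 s1 -> exec m f q s1 t2 s2 ->
      exec m f (Seq p q) s (t1 + t2)%N s2
  | ExecISet s x e :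
      exec m f (ISet x e) s (icost e).+1 (set_ivar s x (ieval s e))
  | ExecIPut s a e1 e2 :
      exec m f (IPut a e1 e2) s (icost e1 + icost e2).+1
        (set_iarr s a (ieval s e1) (ieval s e2))
  | ExecRSet s x e :
      exec m f (RSet x e) s (rcost e).+1 (set_rvar s x (reval s e))
  | ExecRPut s a e1 e2 :
      exec m f (RPut a e1 e2) s (icost e1 + rcost e2).+1
        (set_rarr s a (ieval s e1) (reval s e2))
  | ExecIfTrue b p q s t s1 :
      beval s b -> exec m f p s t s1 ->
      exec m f (If b p q) s (bcost b + t).+1 s1
  | ExecIfFalse b p q s t s1 :
      ~~ beval s b -> exec m f q s t s1 ->
      exec m f (If b p q) s (bcost b + t).+1 s1
  | ExecWhileTrue b p s t1 s1 t2 s2 :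
      beval s b -> exec m f p s t1 s1 -> exec m f (While b p) s1 t2 s2 ->
      exec m f (While b p) s (bcost b + t1 + t2).+1 s2
  | ExecWhileFalse b p s :
      ~~ beval s b -> exec m f (While b p) s (bcost b).+1 s
  | ExecQuery s a b :
      (\sum_(i < kA) read_counts kA s a i <= m)%N ->
      exec m f (Query a b) s (kA * kB).+1
        (write_mixed s b (f (read_counts kA s a))).

Lemma exec_det (R : realType) (kA kB m : nat) (f : count_rule R kA kB)
    (p : cmd) (s s1 s2 : state R) (t1 t2 : nat) :
  exec m f p s t1 s1 -> exec m f p s t2 s2 -> t1 = t2 /\ s1 = s2.
Proof.
move=> e1; elim: e1 t2 s2 => {p s t1 s1}; intros;
  match goal with h : exec _ _ _ _ _ _ |- _ => inversion h; subst end => //;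
  repeat match goal with
  | h : is_true (~~ beval ?s ?b), h' : is_true (beval ?s ?b) |- _ =>
      by rewrite h' in h
  | IH : forall _ _, exec _ _ ?p ?s _ _ -> _, h : exec _ _ ?p ?s _ _ |- _ =>
      case: (IH _ _ h) => ? ?; subst; clear h
  end; by [].
Qed.

(** * Input and output conventions *)

(* Row-major order: u a b is at index a * kB + b. *)
Definition flatten_utility (R : realType) (kA kB : nat) (u : utility R kA kB)
    (n : nat) : R :=
  match insub (n %/ kB)%N, insub (n %% kB)%N with
  | Some a, Some b => u a b
  | _, _ => 0
  end.

(* Integer registers 0, 1, 2, 3 hold kA, kB, m, T and real arrays 0, 1 hold
   the two utilities; all the remaining memory is 0. *)
Definition init_state (R : realType) (kA kB : nat) (uA uB : utility R kA kB)
    (m T : nat) : state R :=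
  State (nth 0%N [:: kA; kB; m; T]) (fun _ _ => 0%N) (fun _ => 0)
    (fun a => if a == 0%N then flatten_utility uA
              else if a == 1%N then flatten_utility uB else fun _ => 0).

(* On halting, integer register 0 holds the length of the cycle and integer
   array 0 its actions. *)
Definition output (R : realType) (s : state R) : seq nat :=
  mkseq (iarr s 0) (ivar s 0).

(* Main.v *)
(* From round m on, the states of the game are the words of the last m actions,
   so player A walks in the de Bruijn graph on N = kA ^ m nodes, and any play
   earns the weight of its walk up to m * H.  Karp's algorithm computes the best
   weight D n v of a walk of n <= N edges ending at v; let lam be the maximum
   over v of min_(k < N) (D N v - D k v) / (N - k).  A walk of n edges weighs at
   most n * lam + N * H.  For a node v realizing lam, a best walk of N edges to v
   repeats a node; cutting out the cycle of l edges in between leaves a walk of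
   N - l edges to v, so the cycle has mean weight at least lam.  Repeating it
   loses O(N * H), since m <= N for kA > 1, while for kA = 1 there is only one
   play. *)
Require Import Defs.
From mathcomp Require Import all_boot all_order all_algebra.
From mathcomp Require Import reals.
From mathcomp Require Import zify lra.
Set Implicit Arguments.
Unset Strict Implicit.
Unset Printing Implicit Defensive.
Import Order.TTheory GRing.Theory Num.Theory.
Local Open Scope ring_scope.

(** * Maximum mean cycles of de Bruijn graphs *)

Section MaxMeanCycle.

Variables (R : realType) (K M : nat) (w : nat -> nat -> R) (H : R).
Hypotheses (K_gt0 : (0 < K)%N) (M_gt0 : (0 < M)%N).
Hypothesis w_bound : forall v a, 0 <= w v a <= H.

Let N := (K * M)%N.

(* Nodes are words in base K, the most recent action being the last digit;
   [M] is the number of nodes divided by [K]. *)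
Definition next_node (v a : nat) : nat := (v %% M * K + a)%N.

(** A predecessor of [v] loses the last digit of [v] and gains a free leading digit [d]; the edge
    back to [v] is labelled by the lost digit [v %% K]. *)
Definition pred_node (v d : nat) : nat := (v %/ K + d * M)%N.

Fixpoint walk_weight (v : nat) (s : seq nat) : R :=
  if s is a :: s' then w v a + walk_weight (next_node v a) s' else 0.

(** Only the end [v] of the walk is prescribed; the start is free, so every node has value [0] at
    length 0. The recursion runs over the last edge. *)
Fixpoint best_walk (n v : nat) : R :=
  if n is n'.+1 then
    \big[Num.max/0]_(d < K)
      (best_walk n' (pred_node v d) + w (pred_node v d) (v %% K))
  else 0.

(** Karp's quotients cleared of denominators: [lower_mean] and [upper_mean] place [lam] below and
    above the minimum over [k] of [(D N v - D k v) / (N - k)], where [D] is [best_walk]. The maximum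
    over all nodes satisfies the first at some node and the second at every node. *)
Definition lower_mean (lam : R) (v : nat) : Prop :=
  forall k, (k < N)%N ->
    lam * (N - k)%:R <= best_walk N v - best_walk k v.

Definition upper_mean (lam : R) (v : nat) : Prop :=
  exists2 k, (k < N)%N &
    best_walk N v - best_walk k v <= lam * (N - k)%:R.

Lemma N_gt0 : (0 < N)%N. Proof. by rewrite muln_gt0 K_gt0. Qed.

Lemma H_ge0 : 0 <= H.
Proof. by have /andP[h1 h2] := w_bound 0 0; apply: le_trans h1 h2. Qed.

Lemma next_node_lt v a : (a < K)%N -> (next_node v a < N)%N.
Proof.
move=> aK; rewrite /next_node /N; have := ltn_pmod v M_gt0.
by move: (v %% M)%N => x xM; nia.
Qed.

Lemma pred_node_lt v d : (v < N)%N -> (d < K)%N -> (pred_node v d < N)%N.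
Proof.
move=> vN dK; rewrite /pred_node /N.
have : (v %/ K < M)%N by rewrite ltn_divLR // mulnC.
by move: (v %/ K)%N => x xM; nia.
Qed.

Lemma next_node_pred_node v d : (v < N)%N ->
  next_node (pred_node v d) (v %% K) = v.
Proof.
move=> vN; rewrite /next_node /pred_node (addnC (v %/ K)%N) modnMDl.
by rewrite modn_small -?divn_eq // ltn_divLR // mulnC.
Qed.

(** A step drops the leading digit [v %/ M]; putting this digit back recovers [v]. *)
Lemma pred_node_next_node v a : (a < K)%N ->
  pred_node (next_node v a) (v %/ M) = v.
Proof.
by move=> aK; rewrite /next_node /pred_node divnMDl // divn_small // addn0 addnC
  -divn_eq.
Qed.

Lemma next_node_mod v a : (a < K)%N -> (next_node v a %% K = a)%N.
Proof. by move=> aK; rewrite /next_node modnMDl modn_small. Qed.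

Lemma best_walk_ge0 n v : 0 <= best_walk n v.
Proof. by case: n => [|n] //=; apply: bigmax_ge_id. Qed.

Lemma best_walk_ge n v d : (d < K)%N ->
  best_walk n (pred_node v d) + w (pred_node v d) (v %% K) <= best_walk n.+1 v.
Proof.
move=> dK /=.
pose F (d : 'I_K) :=
  best_walk n (pred_node v d) + w (pred_node v d) (v %% K).
exact: (le_bigmax _ F (Ordinal dK)).
Qed.

(** All candidates are nonnegative and there is at least one, so the default [0] of the maximum
    never beats the largest of them. *)
Lemma best_walk_attained n v : exists2 d, (d < K)%N &
  best_walk n.+1 v =
    best_walk n (pred_node v d) + w (pred_node v d) (v %% K).
Proof.
pose F (d : 'I_K) :=
  best_walk n (pred_node v d) + w (pred_node v d) (v %% K).
have [|d _ dE] := @eq_bigmax _ _ _ 0 (Ordinal K_gt0) xpredT F isT.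
  move=> d _; rewrite addr_ge0 ?best_walk_ge0 //.
  by case/andP: (w_bound (pred_node v d) (v %% K)).
by exists d.
Qed.

Lemma best_walk_next n v a : (v < N)%N -> (a < K)%N ->
  best_walk n v + w v a <= best_walk n.+1 (next_node v a).
Proof.
move=> vN aK; have dK : (v %/ M < K)%N by rewrite ltn_divLR.
have := best_walk_ge n (next_node v a) dK.
by rewrite pred_node_next_node // next_node_mod.
Qed.

Lemma best_walk_le n v : best_walk n v <= n%:R * H.
Proof.
elim: n v => [|n IH] v; first by rewrite mul0r.
have [d _ ->] := best_walk_attained n v.
rewrite -natr1 mulrDl mul1r lerD //.
by case/andP: (w_bound (pred_node v d) (v %% K)).
Qed.

(** A walk can be prolonged at its free start, and weights are nonnegative. This makes Karp's
    quotients nonnegative. *)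
Lemma best_walk_mono n v : best_walk n v <= best_walk n.+1 v.
Proof.
elim: n v => [|n IH] v; first exact: best_walk_ge0.
have [d dK ->] := best_walk_attained n v.
by apply: le_trans (best_walk_ge _ _ dK); rewrite lerD2r.
Qed.

Lemma best_walk_homo n n' v : (n <= n')%N -> best_walk n v <= best_walk n' v.
Proof.
move=> /subnK <-; elim: (n' - n)%N => // k IH.
by apply: le_trans IH (best_walk_mono _ _).
Qed.

Lemma walk_weight_ge0 v s : 0 <= walk_weight v s.
Proof.
elim: s v => //= a s IH v; rewrite addr_ge0 //.
by case/andP: (w_bound v a).
Qed.

Lemma walk_weight_cat v s1 s2 :
  walk_weight v (s1 ++ s2) =
    walk_weight v s1 + walk_weight (foldl next_node v s1) s2.
Proof. by elim: s1 v => [|a s IH] v /=; rewrite ?add0r // IH addrA. Qed.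

(** Appending [s] to a best walk of [n] edges to [v] gives a competitor for the longer length. The
    case [n = 0] bounds arbitrary walks; other values of [n] serve to glue a walk together after a
    cycle is cut out. *)
Lemma walk_weight_le_best n v s : (v < N)%N -> all (gtn K) s ->
  best_walk n v + walk_weight v s <=
    best_walk (n + size s) (foldl next_node v s).
Proof.
elim: s v n => [|a s IH] v n vN /=; first by rewrite addr0 addn0.
case/andP=> aK sK; rewrite addrA addnS -addSn.
apply: le_trans (IH _ _ (next_node_lt _ aK) sK).
by rewrite lerD2r best_walk_next.
Qed.

(* With the weights shifted by [- lam], the hypothesis says that walks of
   length [N] do not beat the shorter ones; hence the best values over lengths
   below [N] are a fixed point of the Bellman recursion and bound all walks. *)
Lemma best_walk_bellman lam :
  (forall v, (v < N)%N -> upper_mean lam v) ->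
  forall n v, (v < N)%N -> exists2 k, (k < N)%N &
    best_walk n v - n%:R * lam <= best_walk k v - k%:R * lam.
Proof.
move=> up; elim=> [|n IH] v vN; first by exists 0; rewrite ?N_gt0.
have [d dK DE] := best_walk_attained n v.
have [k kN le_k] := IH _ (pred_node_lt vN dK).
have step := best_walk_ge k v dK.
have [k1N|] := ltnP k.+1 N.
  exists k.+1 => //; rewrite DE -!natr1; lra.
(* The prolonged walk has reached length [N]; [upper_mean] at its end trades it for a length [l]
   below [N]. *)
move=> Nk1; have Ek : k.+1 = N by apply/eqP; rewrite eqn_leq kN.
have [l lN le_l] := up v vN; exists l => //.
rewrite Ek in step; rewrite natrB ?(ltnW lN) // in le_l.
have EN : N%:R = k%:R + 1 :> R by rewrite natr1 Ek.
rewrite DE -natr1; rewrite EN in le_l; lra.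
Qed.

(** The walk is dominated by the best one of its length with the same end, which the Bellman bound
    compares with a best walk of fewer than [N] edges; the latter weighs at most [N * H]. *)
Lemma walk_weight_upper lam v s :
  0 <= lam -> (forall v, (v < N)%N -> upper_mean lam v) ->
  (v < N)%N -> all (gtn K) s ->
  walk_weight v s <= (size s)%:R * lam + N%:R * H.
Proof.
move=> lam_ge0 up vN sK.
have := walk_weight_le_best 0 vN sK; rewrite add0r add0n => le1.
have zN : (foldl next_node v s < N)%N.
  elim: s v vN sK {le1} => //= a s IH v vN /andP[aK sK].
  by apply: IH => //; apply: next_node_lt.
have [k kN le2] := best_walk_bellman up (size s) zN.
have le3 := best_walk_le k (foldl next_node v s).
have : k%:R * H <= N%:R * H by rewrite ler_wpM2r ?H_ge0 // ler_nat ltnW.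
have : 0 <= k%:R * lam by rewrite mulr_ge0.
lra.
Qed.

(** The instance [k = 0] gives [lam * N <= D N v <= N * H]. *)
Lemma lower_mean_le lam v : lower_mean lam v -> lam <= H.
Proof.
move=> /(_ 0 N_gt0); rewrite subn0 subr0 => le1.
have := le_trans le1 (best_walk_le N v).
by rewrite mulrC ler_pM2l // ltr0n N_gt0.
Qed.

(** * Best walks traced backwards, and the cycles on them *)

Definition back_path (q : nat -> nat) : Prop :=
  forall s, (s < N)%N -> exists2 d, (d < K)%N &
    q s.+1 = pred_node (q s) d /\
    best_walk (N - s) (q s) =
      best_walk (N - s.+1) (q s.+1) + w (q s.+1) (q s %% K).

(** The labels of the walk from [q j] forward to [q i]: indices decrease in the direction of play,
    and the edge into a node is labelled by the last digit of that node. *)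
Definition path_actions (q : nat -> nat) (i j : nat) : seq nat :=
  mkseq (fun t => q (j.-1 - t) %% K)%N (j - i).

Lemma path_actionsS q i j : (i <= j)%N ->
  path_actions q i j.+1 = (q j %% K)%N :: path_actions q i j.
Proof.
move=> ij; rewrite /path_actions subSn // /mkseq /= subn0; congr (_ :: _).
rewrite (iotaDl 1 0) -map_comp; apply: eq_map => t /=.
by congr (q _ %% K)%N; lia.
Qed.

Lemma all_path_actions q i j : all (gtn K) (path_actions q i j).
Proof. by apply/allP => x /mapP[t _ ->]; rewrite /= ltn_pmod. Qed.

Section BackPath.

Variable q : nat -> nat.
Hypotheses (q0 : (q 0 < N)%N) (qP : back_path q).

Lemma back_path_lt s : (s <= N)%N -> (q s < N)%N.
Proof.
elim: s => // s IH sN; have [d dK [-> _]] := qP sN.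
by rewrite pred_node_lt // IH // ltnW.
Qed.

Lemma foldl_path_actions i j : (i <= j <= N)%N ->
  foldl next_node (q j) (path_actions q i j) = q i.
Proof.
elim: j => [|j IH] /andP[ij jN].
  by move: ij; rewrite leqn0 => /eqP->.
move: ij; rewrite leq_eqVlt => /predU1P[->|ij].
  by rewrite /path_actions subnn.
rewrite path_actionsS //=; have [d dK [-> _]] := qP jN.
rewrite next_node_pred_node; last exact/back_path_lt/ltnW.
by apply: IH; rewrite -ltnS ij ltnW.
Qed.

(** Each edge of the traced walk weighs exactly the difference of two consecutive best values, so
    the sum telescopes. *)
Lemma walk_weight_path_actions i j : (i <= j <= N)%N ->
  walk_weight (q j) (path_actions q i j) =
    best_walk (N - i) (q i) - best_walk (N - j) (q j).
Proof.
elim: j => [|j IH] /andP[ij jN].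
  by move: ij; rewrite leqn0 => /eqP->; rewrite subrr.
move: ij; rewrite leq_eqVlt => /predU1P[->|ij].
  by rewrite /path_actions subnn subrr.
rewrite path_actionsS //=; have [d dK [Eq Ew]] := qP jN.
rewrite {2}Eq next_node_pred_node; last exact/back_path_lt/ltnW.
rewrite IH; last by rewrite -ltnS ij ltnW.
lra.
Qed.

(* Cutting the cycle out of the best walk leaves a shorter walk to [q 0]. *)
Lemma cycle_mean_ge lam i j :
  lower_mean lam (q 0) -> (i < j <= N)%N -> q i = q j ->
  (size (path_actions q i j))%:R * lam <=
    walk_weight (q j) (path_actions q i j).
Proof.
move=> low /andP[ij jN] qij; rewrite size_mkseq.
have iN : (i <= N)%N by lia.
rewrite walk_weight_path_actions ?(ltnW ij) //.
have := walk_weight_le_best (N - j) (back_path_lt iN) (all_path_actions q 0 i).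
rewrite foldl_path_actions ?leq0n // walk_weight_path_actions ?leq0n //.
rewrite size_mkseq !subn0 -qij.
(* [N - j + i] edges remain after the cut; for this [k] the denominator [N - k] is the length of the
   cycle. *)
have := low (N - j + i)%N; rewrite (_ : N - (N - j + i) = j - i)%N; last lia.
move=> /(_ ltac:(lia)) h1 h2; rewrite mulrC; lra.
Qed.

End BackPath.

(** * Repeating a closed walk *)

Definition periodic (c : seq nat) (T : nat) : seq nat :=
  mkseq (fun t => nth 0%N c (t %% size c)) T.

Lemma periodic_cat c T :
  (0 < size c)%N -> periodic c (size c + T) = c ++ periodic c T.
Proof.
move=> c0; rewrite /periodic /mkseq iotaD map_cat; congr (_ ++ _).
  rewrite -[RHS](mkseq_nth 0%N); apply/eq_in_map => t.
  by rewrite mem_iota => /andP[_ tc]; rewrite modn_small.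
rewrite add0n -[X in iota X]addn0 iotaDl -map_comp.
by apply: eq_map => t /=; rewrite modnDl.
Qed.

(** Every full turn comes back to [v] and earns its length times [lam]. The unfinished last turn is
    shorter than [N], so counting it as zero loses at most [N * lam <= N * H]. *)
Lemma periodic_lower lam v c T :
  0 <= lam <= H -> (0 < size c <= N)%N -> foldl next_node v c = v ->
  (size c)%:R * lam <= walk_weight v c ->
  T%:R * lam - N%:R * H <= walk_weight v (periodic c T).
Proof.
move=> /andP[lam0 lamH] /andP[c0 cN] cv cw.
elim/ltn_ind: T => T IH; have [Tc|cT] := ltnP T (size c).
  apply: le_trans (walk_weight_ge0 _ _); rewrite subr_le0.
  by apply: ler_pM => //; rewrite ler_nat; lia.
rewrite -(subnKC cT) periodic_cat // walk_weight_cat cv natrD.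
have := IH (T - size c)%N ltac:(lia); lra.
Qed.

End MaxMeanCycle.

(** * Windows of actions as nodes *)

(** The least significant digit comes first, hence the most recent action does. *)
Fixpoint digits (K m v : nat) : seq nat :=
  if m is m'.+1 then (v %% K)%N :: digits K m' (v %/ K)%N else [::].

Lemma size_digits K m v : size (digits K m v) = m.
Proof. by elim: m v => //= m IH v; rewrite IH. Qed.

Lemma all_digits K m v : (0 < K)%N -> all (gtn K) (digits K m v).
Proof. by move=> K0; elim: m v => //= m IH v; rewrite ltn_pmod ?IH. Qed.

Lemma digits_modX K m v : (0 < K)%N ->
  digits K m (v %% K ^ m)%N = digits K m v.
Proof.
move=> K0; elim: m v => //= m IH v.
rewrite expnS modn_dvdm ?dvdn_mulr //; congr (_ :: _).
by rewrite mulnC -modn_divl IH.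
Qed.

Lemma take_digits K m v : take m (digits K m.+1 v) = digits K m v.
Proof.
elim: m v => //= m IH v; congr (_ :: _).
by rewrite -[RHS]IH.
Qed.

Lemma digits_next_node K m v a : (a < K)%N ->
  digits K m.+1 (next_node K (K ^ m) v a) = take m.+1 (a :: digits K m.+1 v).
Proof.
move=> aK; have K0 : (0 < K)%N by case: K aK.
rewrite [LHS]/= /next_node modnMDl modn_small // divnMDl // divn_small // addn0.
by rewrite digits_modX // -take_digits.
Qed.

(** Each step pushes an action in front and drops the oldest one; after [m.+1] steps nothing of [v]
    is left. *)
Lemma digits_foldl_next K m v s : all (gtn K) s ->
  digits K m.+1 (foldl (next_node K (K ^ m)) v s)
    = take m.+1 (rev s ++ digits K m.+1 v).
Proof.
elim/last_ind: s => [|s a IH]; first by rewrite take_oversize ?size_digits.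
rewrite all_rcons => /andP[aK sK].
by rewrite foldl_rcons digits_next_node // IH // rev_rcons /= take_takel.
Qed.

Lemma walk_weight_sum (R : realType) K M (w : nat -> nat -> R) v s :
  walk_weight K M w v s =
    \sum_(t < size s) w (foldl (next_node K M) v (take t s)) (nth 0%N s t).
Proof.
elim: s v => [|a s IH] v /=; first by rewrite big_ord0.
by rewrite big_ord_recl /= IH.
Qed.

(** * Comparing payoffs of the game with weights of walks *)

Section Window.

Variables (R : realType) (kA kB m : nat) (uA : utility R kA kB).
Variables (f : count_rule R kA kB) (H : R).
Hypotheses (kA_gt0 : (0 < kA)%N) (kB_gt0 : (0 < kB)%N).
Hypothesis f_rule : is_rule m.+1 f.
Hypothesis uA_bound : forall a b, 0 <= uA a b <= H.

(** The memory length is [m.+1], so nodes are words of [m.+1] digits and the parameter [M] of the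
    graph becomes [kA ^ m]. *)
Definition node_counts (v : nat) : {ffun 'I_kA -> nat} :=
  [ffun a : 'I_kA => count_mem (val a) (digits kA m.+1 v)].

Definition edge_weight (v a : nat) : R :=
  \sum_(b < kB) f (node_counts v) b * flatten_utility uA (a * kB + b).

Lemma flatten_utilityE (a : 'I_kA) (b : 'I_kB) :
  flatten_utility uA (a * kB + b) = uA a b.
Proof.
rewrite /flatten_utility divnMDl // divn_small // addn0 modnMDl modn_small //.
by rewrite !valK.
Qed.

(** Indices outside the table are covered too, through the default [0], so that edge weights are
    bounded for all natural numbers, as [w_bound] demands. *)
Lemma flatten_utility_bound n : 0 <= flatten_utility uA n <= H.
Proof.
have H0 : 0 <= H.
  have /andP[h1 h2] := uA_bound (Ordinal kA_gt0) (Ordinal kB_gt0).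
  exact: le_trans h1 h2.
rewrite /flatten_utility; case: insubP => [a _ _|_]; last by rewrite lexx.
by case: insubP => [b _ _|_]; rewrite ?lexx.
Qed.

Lemma average_bound (beta g : 'I_kB -> R) :
  is_mixed beta -> (forall b, 0 <= g b <= H) ->
  0 <= \sum_(b < kB) beta b * g b <= H.
Proof.
move=> [beta0 beta1] gH; apply/andP; split.
  by apply: sumr_ge0 => b _; rewrite mulr_ge0 //; case/andP: (gH b).
rewrite -[H]mul1r -beta1 mulr_suml; apply: ler_sum => b _.
by rewrite ler_wpM2l //; case/andP: (gH b).
Qed.

Lemma sum_count_size (s : seq 'I_kA) : (\sum_(a < kA) count_mem a s = size s)%N.
Proof.
elim: s => [|x s IH] /=; first by rewrite big1.
rewrite big_split /= IH (bigD1 x) //= eqxx big1 // => a /negPf ax.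
by rewrite eq_sym ax.
Qed.

Lemma node_countsE (v : nat) (s : seq 'I_kA) :
  perm_eq (digits kA m.+1 v) (map val s) -> node_counts v = counts s.
Proof.
move=> vs; apply/ffunP => a; rewrite !ffunE (permP vs) count_map.
by apply: eq_count => x.
Qed.

(** Every node is a full window, which keeps the queries inside the domain of the rule. *)
Lemma node_counts_sum v : (\sum_(a < kA) node_counts v a = m.+1)%N.
Proof.
have [s sE] : exists s : seq 'I_kA, map val s = digits kA m.+1 v.
  exists [seq insubd (Ordinal kA_gt0) x | x <- digits kA m.+1 v].
  rewrite -map_comp -[RHS]map_id; apply/eq_in_map => x xv /=.
  have /= xK := allP (all_digits m.+1 v kA_gt0) x xv.
  by rewrite val_insubd xK.
rewrite (node_countsE (s := s)) ?sE //.
under eq_bigr do rewrite ffunE.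
by rewrite sum_count_size -(size_map val) sE size_digits.
Qed.

Lemma edge_weight_bound v a : 0 <= edge_weight v a <= H.
Proof.
apply: average_bound => [|b]; last exact: flatten_utility_bound.
by apply: f_rule; rewrite node_counts_sum.
Qed.

Let nxt := next_node kA (kA ^ m).

(** The window is full, so it no longer depends on the starting node. The digits list it in reverse
    order, which counts cannot see. *)
Lemma recent_digits (s : seq 'I_kA) v t : (m < t <= size s)%N ->
  perm_eq (digits kA m.+1 (foldl nxt v (take t (map val s))))
          (map val (recent m.+1 t s)).
Proof.
move=> /andP[mt ts]; rewrite -map_take digits_foldl_next; last first.
  by apply/allP => _ /mapP[a _ ->] /=.
rewrite takel_cat ?size_rev ?size_map ?size_takel //.
rewrite take_rev size_map size_takel // /recent map_drop.
by rewrite perm_rev.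
Qed.

Lemma round_bound (a : 'I_kA) (s : seq 'I_kA) t :
  0 <= mixed_payoff uA a (f (counts (recent m.+1 t s))) <= H.
Proof.
apply: average_bound => //; apply: f_rule.
under eq_bigr do rewrite ffunE.
rewrite sum_count_size /recent size_drop.
have := geq_minl t (size s); rewrite -size_take_min; lia.
Qed.

Lemma sum_ltn_bound (T : nat) : 0 <= H ->
  \sum_(t < T) (t < m.+1)%:R * H <= m.+1%:R * H.
Proof.
move=> H0; rewrite -mulr_suml ler_wpM2r // -natr_sum ler_nat.
suff -> : (\sum_(t < T) (t < m.+1) = minn T m.+1)%N by apply: geq_minr.
elim: T => [|T IH]; first by rewrite big_ord0 min0n.
by rewrite big_ord_recr /= IH; case: ltnP; lia.
Qed.

(** Only the first [m.+1] rounds can differ, where the walk still sees digits of [v]; there both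
    terms lie in [[0, H]]. The start [v] is arbitrary. *)
Lemma payoff_walk (T v : nat) (x : T.-tuple 'I_kA) :
  `|payoff uA m.+1 f x - walk_weight kA (kA ^ m) edge_weight v (map val x)|
    <= m.+1%:R * H.
Proof.
have H0 : 0 <= H.
  have /andP[h1 h2] := uA_bound (Ordinal kA_gt0) (Ordinal kB_gt0).
  exact: le_trans h1 h2.
rewrite walk_weight_sum size_map size_tuple /payoff -sumrB.
apply: le_trans (ler_norm_sum _ _ _) _.
apply: le_trans (sum_ltn_bound T H0); apply: ler_sum => t _.
rewrite (nth_map (tnth x t)) ?size_tuple // -tnth_nth.
have [tm|mt] := ltnP; last first.
  rewrite mul0r normr_le0 subr_eq0 /mixed_payoff /edge_weight.
  rewrite (@node_countsE _ (recent m.+1 t x)); last first.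
    by apply: recent_digits; rewrite size_tuple mt ltnW.
  by apply/eqP/eq_bigr => b _; rewrite flatten_utilityE.
rewrite mul1r.
have := round_bound (tnth x t) x t.
have := edge_weight_bound (foldl nxt v (take t (map val x))) (tnth x t).
by move=> /andP[h1 h2] /andP[h3 h4]; rewrite ler_norml; apply/andP; split; lra.
Qed.

End Window.

(** * Timed Hoare triples *)

Section TimedTriples.

Variables (R : realType) (kA kB m : nat) (f : count_rule R kA kB).
Implicit Types (s : state R) (c : cmd) (Q : state R -> Prop).

(** The state comes last so that [wp q n2 Q] can itself be a postcondition, as in [wp_seq]. *)
Definition wp c (n : nat) Q s : Prop :=
  exists t s', [/\ exec m f c s t s', (t <= n)%N & Q s'].

Lemma wp_weaken c n n' Q Q' s :
  wp c n Q s -> (n <= n')%N -> (forall s', Q s' -> Q' s') -> wp c n' Q' s.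
Proof.
move=> [t [s' [e tn q]]] nn QQ; exists t, s'.
by split; [|apply: leq_trans nn|apply: QQ].
Qed.

Lemma wp_cost c n n' Q s : (n <= n')%N -> wp c n Q s -> wp c n' Q s.
Proof. by move=> nn h; apply: wp_weaken h nn _. Qed.

Lemma wp_seq p q n1 n2 Q s :
  wp p n1 (wp q n2 Q) s -> wp (Seq p q) (n1 + n2) Q s.
Proof.
move=> [t1 [s1 [e1 le1 [t2 [s2 [e2 le2 h]]]]]].
by exists (t1 + t2)%N, s2; split; [apply: ExecSeq e1 e2 | apply: leq_add|].
Qed.

Lemma wp_query a b n Q s :
  (\sum_(i < kA) read_counts kA s a i <= m)%N ->
  (kA * kB < n)%N -> Q (write_mixed s b (f (read_counts kA s a))) ->
  wp (Query a b) n Q s.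
Proof.
move=> le_m le_n q.
exists (kA * kB).+1, (write_mixed s b (f (read_counts kA s a))).
by split=> //; apply: ExecQuery.
Qed.

(** * Loop-free programs, executed by computation *)

Fixpoint straight c : bool :=
  match c with
  | Seq p q | If _ p q => straight p && straight q
  | While _ _ | Query _ _ => false
  | _ => true
  end.

Fixpoint run c s : state R :=
  match c with
  | Seq p q => run q (run p s)
  | If b p q => if beval s b then run p s else run q s
  | ISet x e => set_ivar s x (ieval s e)
  | IPut a e1 e2 => set_iarr s a (ieval s e1) (ieval s e2)
  | RSet x e => set_rvar s x (reval s e)
  | RPut a e1 e2 => set_rarr s a (ieval s e1) (reval s e2)
  | _ => s
  end.

(** To be independent of the state, the bound charges a conditional for both branches. *)
Fixpoint run_cost c : nat :=
  match c with
  | Seq p q => run_cost p + run_cost q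
  | If b p q => (bcost b + (run_cost p + run_cost q)).+1
  | ISet _ e => (icost e).+1
  | IPut _ e1 e2 => (icost e1 + icost e2).+1
  | RSet _ e => (rcost e).+1
  | RPut _ e1 e2 => (icost e1 + rcost e2).+1
  | _ => 1
  end.

Lemma exec_run c s : straight c ->
  exists2 t, exec m f c s t (run c s) & (t <= run_cost c)%N.
Proof.
elim: c s => //=; try by move=> *; eexists; [constructor|].
- move=> p IHp q IHq s /andP[sp sq].
  have [t1 e1 le1] := IHp s sp; have [t2 e2 le2] := IHq (run p s) sq.
  by exists (t1 + t2)%N; [apply: ExecSeq e1 e2 | apply: leq_add].
- move=> b p IHp q IHq s /andP[sp sq]; case: (boolP (beval s b)) => sb.
    have [t e le] := IHp s sp; exists (bcost b + t).+1; first exact: ExecIfTrue.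
    by rewrite ltnS leq_add2l (leq_trans le) // leq_addr.
  have [t e le] := IHq s sq; exists (bcost b + t).+1; first exact: ExecIfFalse.
  by rewrite ltnS leq_add2l (leq_trans le) // leq_addl.
Qed.

Lemma wp_run c n Q s :
  straight c -> (run_cost c <= n)%N -> Q (run c s) -> wp c n Q s.
Proof.
move=> /(exec_run s)[t e le1] le2 q; exists t, (run c s).
by split=> //; apply: leq_trans le2.
Qed.

(* [k = 0, 1, 2, 3]: integer registers, integer arrays, real registers, real
   arrays. *)
Fixpoint writes (k : nat) c : seq nat :=
  match c with
  | Seq p q | If _ p q => writes k p ++ writes k q
  | While _ p => writes k p
  | ISet x _ => if k == 0%N then [:: x] else [::]
  | IPut a _ _ => if k == 1%N then [:: a] else [::]
  | RSet x _ => if k == 2%N then [:: x] else [::]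
  | RPut a _ _ => if k == 3%N then [:: a] else [::]
  | Query _ b => if k == 3%N then [:: b] else [::]
  | Skip => [::]
  end.

Definition frame c s s' : Prop :=
  [/\ forall x, x \notin writes 0 c -> ivar s' x = ivar s x,
      forall x, x \notin writes 1 c -> iarr s' x = iarr s x,
      forall x, x \notin writes 2 c -> rvar s' x = rvar s x &
      forall x, x \notin writes 3 c -> rarr s' x = rarr s x].

Lemma frame_sub c p s s' :
  (forall k, {subset writes k p <= writes k c}) ->
  frame p s s' -> frame c s s'.
Proof.
move=> pc [h0 h1 h2 h3]; split=> x xc.
- by apply: h0; apply: contra xc; apply: pc.
- by apply: h1; apply: contra xc; apply: pc.
- by apply: h2; apply: contra xc; apply: pc.
- by apply: h3; apply: contra xc; apply: pc.
Qed.

Lemma frame_trans c s s1 s2 : frame c s s1 -> frame c s1 s2 -> frame c s s2.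
Proof.
move=> [h0 h1 h2 h3] [k0 k1 k2 k3]; split=> x xc.
- by rewrite k0 ?h0.
- by rewrite k1 ?h1.
- by rewrite k2 ?h2.
- by rewrite k3 ?h3.
Qed.

Lemma exec_frame c s t s' : exec m f c s t s' -> frame c s s'.
Proof.
elim=> {c s t s'} //.
- move=> p q s t1 s1 t2 s2 _ h1 _ h2; apply: frame_trans.
    by apply: frame_sub h1 => k x; rewrite mem_cat => ->.
  by apply: frame_sub h2 => k x; rewrite mem_cat => ->; rewrite orbT.
- by move=> s x e; split=> //= y; rewrite inE /upd => /negPf->.
- by move=> s x e1 e2; split=> //= y; rewrite inE /upd => /negPf->.
- by move=> s x e; split=> //= y; rewrite inE /upd => /negPf->.
- by move=> s x e1 e2; split=> //= y; rewrite inE /upd => /negPf->.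
- move=> b p q s t s1 _ _ h.
  by apply: frame_sub h => k x; rewrite mem_cat => ->.
- move=> b p q s t s1 _ _ h.
  by apply: frame_sub h => k x; rewrite mem_cat => ->; rewrite orbT.
- by move=> b p s t1 s1 t2 s2 _ _ h1 _ h2; apply: frame_trans h1 h2.
- by move=> s a b _; split=> //= y; rewrite inE /upd => /negPf->.
Qed.

(** What a program leaves unchanged is read off its syntax, so invariants and postconditions need
    only mention what it changes. *)
Lemma wp_frame c n Q s :
  wp c n (fun s' => frame c s s' -> Q s') s -> wp c n Q s.
Proof.
move=> [t [s' [e tn q]]]; exists t, s'; split=> //.
exact/q/(exec_frame e).
Qed.

(** * Counting loops *)

Definition For (x y : nat) (body : cmd) : cmd :=
  Seq (ISet x (IConst 0))
    (While (BNot (BIle (IVar y) (IVar x)))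
       (Seq body (ISet x (IOp IAdd (IVar x) (IConst 1))))).

(** A round costs [B] for the body, 5 for the test and 4 for the increment; the final 7 pays for the
    initialisation and the last, failing test. The body may write neither the counter [x] nor the
    bound [y]. *)
Lemma wp_for x y body (Inv : nat -> state R -> Prop) n B b Q s :
  x \notin writes 0 body -> y \notin x :: writes 0 body -> ivar s y = n ->
  (n * (B + 9) + 7 <= b)%N ->
  Inv 0 (set_ivar s x 0) ->
  (forall i s1, (i < n)%N -> frame (For x y body) s s1 -> ivar s1 x = i ->
     Inv i s1 -> wp body B (fun s2 => Inv i.+1 (set_ivar s2 x i.+1)) s1) ->
  (forall s', frame (For x y body) s s' -> Inv n s' -> Q s') ->
  wp (For x y body) b Q s.
Proof.
move=> xb yxb yn bE Inv0 step post.
have /norP[yx yb] : ~~ ((y == x) || (y \in writes 0 body)) by rewrite -in_cons.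
apply: wp_frame; set Q' := fun s' => _.
pose loop := While (BNot (BIle (IVar y) (IVar x)))
  (Seq body (ISet x (IOp IAdd (IVar x) (IConst 1)))).
(* The induction is on the number [k] of rounds still to run. *)
have loopP k : forall i s1, (i + k = n)%N -> frame (For x y body) s s1 ->
    ivar s1 x = i -> Inv i s1 -> wp loop (k * (B + 9) + 5) Q' s1.
  elim: k => [|k IH] i s1 ikn fr s1x Invi.
    have [fr0 _ _ _] := fr.
    have s1y : ivar s1 y = n.
      by rewrite fr0 //= !inE mem_cat inE (negPf yx) (negPf yb).
    exists 5%N, s1; split=> //.
      by apply: ExecWhileFalse; rewrite /= s1y s1x -ikn addn0 leqnn.
    by move=> fr'; apply: post => //; rewrite -ikn addn0.
  have iltn : (i < n)%N by rewrite -ikn -addSnnS leq_addr.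
  have [fr0 _ _ _] := fr.
  have s1y : ivar s1 y = n.
    by rewrite fr0 //= !inE mem_cat inE (negPf yx) (negPf yb).
  have [t [s2 [e2 tB Inv2]]] := step i s1 iltn fr s1x Invi.
  have [fb _ _ _] := exec_frame e2.
  have s2x : ivar s2 x = i by rewrite fb.
  have e3 : exec m f (Seq body (ISet x (IOp IAdd (IVar x) (IConst 1)))) s1
      (t + 4) (set_ivar s2 x i.+1).
    apply: ExecSeq e2 _.
    have := ExecISet m f s2 x (IOp IAdd (IVar x) (IConst 1)).
    by rewrite /= s2x (addn1 i).
  have [||||t' [s' [e' t'B q']]] := IH i.+1 (set_ivar s2 x i.+1).
  - by rewrite addSnnS.
  - apply: frame_trans fr _; apply: frame_sub (exec_frame e3) => k' z zk.
    by rewrite [writes _ _]/= mem_cat; apply/orP; right.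
  - by rewrite /= /upd eqxx.
  - exact: Inv2.
  exists (4 + (t + 4) + t').+1, s'; split=> //; last lia.
  by apply: ExecWhileTrue e3 e' => /=; rewrite s1y s1x -ltnNge.
apply: (@wp_cost _ (2 + (n * (B + 9) + 5))); first lia.
apply: wp_seq; exists 2%N, (set_ivar s x 0); split=> //; first exact: ExecISet.
apply: (loopP n 0) => //=.
  by split=> //= z; rewrite inE /upd => /norP[/negPf->].
by rewrite /upd eqxx.
Qed.

End TimedTriples.

Arguments wp_cost {R kA kB m f c} n {n' Q s}.
Arguments wp_for {R kA kB m f x y body} Inv n B {b Q s}.

(** * Karp's algorithm as a program *)

Local Coercion IVar : nat >-> iexpr.
Local Coercion RVar : nat >-> rexpr.

Local Notation iadd := (IOp IAdd).
Local Notation isub := (IOp ISub).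
Local Notation imul := (IOp IMul).
Local Notation idiv := (IOp IDiv).
Local Notation imod := (IOp IMod).

Local Notation rK := 0%N.
Local Notation rB := 1%N.
Local Notation rm := 2%N.
Local Notation rN := 4%N.
Local Notation rM := 5%N.
Local Notation rv := 6%N.
Local Notation ra := 7%N.
Local Notation ri := 8%N.
Local Notation re := 9%N.
Local Notation rx := 10%N.
Local Notation rb := 11%N.
Local Notation rNN := 12%N.
Local Notation rt := 13%N.
Local Notation rbase := 14%N.
Local Notation ru := 15%N.
Local Notation rp := 16%N.
Local Notation rbestv := 17%N.
Local Notation rj := 18%N.
Local Notation rbi := 19%N.
Local Notation rbj := 20%N.
Local Notation rL := 21%N.

Local Notation fAcc := 0%N.
Local Notation fBest := 1%N.
Local Notation fCand := 2%N.
Local Notation fLam := 3%N.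
Local Notation fCur := 4%N.

Local Notation aOut := 0%N.
Local Notation aCount := 1%N.
Local Notation aPred := 2%N.
Local Notation aPath := 3%N.

Local Notation aU := 0%N.
Local Notation aBeta := 2%N.
Local Notation aW := 3%N.
Local Notation aD := 4%N.

(** * Computing the number of nodes and the edge weights *)

Definition count_nodes : cmd :=
  Seq (ISet rN (IConst 1))
    (Seq (For ri rm (ISet rN (imul rN rK)))
       (ISet rM (idiv rN rK))).

Definition count_digits : cmd :=
  Seq (For ra rK (IPut aCount ra (IConst 0)))
    (Seq (ISet rx rv)
       (For ri rm
          (Seq (IPut aCount (imod rx rK)
                  (iadd (IGet aCount (imod rx rK)) (IConst 1)))
             (ISet rx (idiv rx rK))))).

Definition store_weight : cmd :=
  Seq (RSet fAcc (RCast (IConst 0)))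
    (Seq (For rb rB
            (RSet fAcc (ROp RAdd fAcc
               (ROp RMul (RGet aBeta rb) (RGet aU (iadd (imul ra rB) rb))))))
       (Seq (RPut aW re fAcc) (ISet re (iadd re (IConst 1))))).

Definition compute_weights : cmd :=
  Seq (ISet re (IConst 0))
    (For rv rN
       (Seq count_digits
          (Seq (Query aCount aBeta) (For ra rK store_weight)))).

Section Phases.

Variables (R : realType) (kA kB m : nat) (uA : utility R kA kB).
Variables (f : count_rule R kA kB) (H : R).
Hypotheses (kA_gt0 : (0 < kA)%N) (kB_gt0 : (0 < kB)%N).
Hypothesis f_rule : is_rule m.+1 f.
Hypothesis uA_bound : forall a b, 0 <= uA a b <= H.

Let M := (kA ^ m)%N.
Let N := (kA * M)%N.
Let W := edge_weight m uA f.

Definition holds_input (s : state R) : Prop :=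
  [/\ ivar s rK = kA, ivar s rB = kB, ivar s rm = m.+1 &
      rarr s aU = flatten_utility uA].

Definition holds_sizes (s : state R) : Prop :=
  [/\ holds_input s, ivar s rN = N & ivar s rM = M].

Lemma holds_sizes_frame c s s' :
  frame c s s' -> all (fun x => x \notin writes 0 c) [:: rK; rB; rm; rN; rM] ->
  aU \notin writes 3 c -> holds_sizes s -> holds_sizes s'.
Proof.
move=> [h0 _ _ h3] /and5P[c0 c1 c2 c4 /andP[c5 _]] u [[e0 e1 e2 eu] e4 e5].
by split; [split|..]; rewrite ?h0 ?h3.
Qed.

Lemma count_nodesP s : holds_input s ->
  wp m.+1 f count_nodes (m.+1 * 15 + 30) holds_sizes s.
Proof.
move=> [e0 e1 e2 eu]; apply: wp_frame.
apply: (wp_cost (3 + (m.+1 * 15 + 8 + 5))); first lia.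
apply: wp_seq; apply: wp_run => //=; apply: wp_seq.
apply: (wp_for (fun i s' => ivar s' rN = kA ^ i)%N m.+1 5) => //.
- lia.
- move=> i s1 _ [h0 _ _ _] _ s1N; apply: wp_run => //=.
  by rewrite /= /upd /= s1N h0 //= /upd /= e0 expnSr.
- move=> s1 [h0 _ _ _] s1N; apply: wp_run => //= [[k0 _ _ k3]].
  split; first by split; rewrite ?k0 ?k3 /=.
    by rewrite /= /upd /= s1N expnS.
  by rewrite /= /upd /= s1N h0 // /= /upd /= e0 expnS mulKn.
Qed.

Lemma count_digitsP s v : holds_sizes s -> ivar s rv = v ->
  wp m.+1 f count_digits (kA * 20 + m.+1 * 40 + 30)
    (fun s' => forall a, (a < kA)%N ->
       iarr s' aCount a = count_mem a (digits kA m.+1 v)) s.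
Proof.
move=> [[e0 e1 e2 eu] eN eM] ev.
apply: (wp_cost ((kA * 12 + 8) + (2 + (m.+1 * 25 + 8)))); first lia.
apply: wp_seq.
apply: (wp_for
  (fun i s' => forall a, (a < i)%N -> iarr s' aCount a = 0)%N kA 3) => //.
- lia.
- move=> i s1 _ _ s1i Inv; apply: wp_run => //= a.
  rewrite /= /upd /= s1i ltnS leq_eqVlt => /predU1P[->|ai].
    by rewrite eqxx.
  by case: eqP => // _; apply: Inv.
move=> s1 [h0 h1 _ _] zero; apply: wp_seq; apply: wp_run => //=.
(* The occurrences counted so far and those among the digits of the quotient left in [rx] add up to
   the total. *)
apply: (wp_for (fun i s' => forall a, (a < kA)%N ->
  iarr s' aCount a + count_mem a (digits kA (m.+1 - i) (ivar s' rx)) =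
    count_mem a (digits kA m.+1 v))%N m.+1 16) => //.
- by rewrite /= /upd /= h0.
- lia.
- move=> a aK; rewrite [iarr _ _ _]/= zero // add0n subn0.
  by rewrite /= /upd /= h0 //= ev.
- move=> i s2 im [k0 _ _ _] _ Inv; apply: wp_run => // a aK.
  have s2K : ivar s2 rK = kA by rewrite k0 //= /upd /= h0.
  rewrite -(Inv a aK) subSS (subSn (im : i <= m)%N) /= /upd /= s2K.
  by rewrite eq_sym; case: eqP => [->|_]; rewrite -?addnA ?add0n ?addn0.
- move=> s2 _ Inv a aK; have := Inv a aK.
  by rewrite subnn /= addn0.
Qed.

Lemma store_weightP s v a :
  holds_sizes s -> ivar s ra = a -> (a < kA)%N -> ivar s re = (v * kA + a)%N ->
  (forall b : 'I_kB, rarr s aBeta b = f (node_counts kA m v) b) ->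
  (forall j, (j < ivar s re)%N -> rarr s aW j = W (j %/ kA) (j %% kA)) ->
  wp m.+1 f store_weight (kB * 30 + 30)
    (fun s' => ivar s' re = (v * kA + a).+1 /\
     forall j, (j < ivar s' re)%N -> rarr s' aW j = W (j %/ kA) (j %% kA)) s.
Proof.
move=> [[e0 e1 e2 eu] eN eM] ea aK ee eb eW.
apply: (wp_cost (3 + (kB * 21 + 8 + 7))); first lia.
apply: wp_seq; apply: wp_run => //=; apply: wp_seq.
apply: (wp_for (fun i s' => rvar s' fAcc =
  \sum_(0 <= b < i) rarr s aBeta b * flatten_utility uA (a * kB + b))
  kB 12) => //.
- lia.
- by rewrite /= /upd /= big_geq.
- move=> i s1 _ [h0 _ _ h3] s1b Inv; apply: wp_run => //=.
  rewrite /= /upd /= s1b Inv big_nat_recr //= !h3 //= eu.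
  by rewrite (h0 ra) // (h0 rB) //= ea e1.
move=> s1 [h0 _ _ h3] Inv; apply: wp_run => //=.
rewrite /= /upd /= !h0 //= /upd /= ee addn1; split=> // j.
rewrite h3 //= ltnS leq_eqVlt => /predU1P[->|jl].
  rewrite eqxx Inv divnMDl // divn_small // addn0 modnMDl modn_small //.
  by rewrite big_mkord; apply: eq_bigr => b _; rewrite eb.
by rewrite (ltn_eqF jl) eW // ee.
Qed.

Lemma compute_weightsP s : holds_sizes s ->
  wp m.+1 f compute_weights (N * (kA * kB * 100 + m.+1 * 40 + 120) + 30)
    (fun s' => forall j, (j < N * kA)%N ->
       rarr s' aW j = W (j %/ kA) (j %% kA)) s.
Proof.
move=> es.
set cost := (kA * kB * 100 + m.+1 * 40 + 120)%N.
apply: (wp_cost (2 + (N * cost + 20))); first lia.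
apply: wp_seq; apply: wp_run => //=.
(* The register [re] numbers the edges in row-major order, so one predicate serves both loops: at
   [i * kA] between nodes and at [v * kA + a] within a node. *)
pose Q e (s' : state R) := ivar s' re = e /\
  forall j, (j < e)%N -> rarr s' aW j = W (j %/ kA) (j %% kA).
have kAB : (kA <= kA * kB)%N by rewrite leq_pmulr.
apply: (wp_for (fun i s' => Q (i * kA) s')%N N (cost - 9)) => //.
- by case: es => [_ e _]; rewrite /= /upd.
- by rewrite subnK /cost; lia.
- move=> v s1 vN fr s1v [s1e s1W].
  have es1 : holds_sizes s1 by apply: (holds_sizes_frame fr).
  apply: (wp_cost ((kA * 20 + m.+1 * 40 + 30) +
    ((kA * kB).+1 + (kA * (kB * 30 + 39) + 8)))); first
    by rewrite /cost mulnDr mulnA; lia.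
  apply: wp_seq; apply: wp_frame.
  apply: wp_weaken (count_digitsP es1 s1v) _ _ => // s2 s2c fr2.
  have es2 : holds_sizes s2 by apply: (holds_sizes_frame fr2).
  have [h0 _ _ h3] := fr2.
  have cE : read_counts kA s2 aCount = node_counts kA m v.
    by apply/ffunP => a; rewrite !ffunE s2c.
  apply: wp_seq; apply: wp_query => //; rewrite cE.
    by rewrite node_counts_sum.
  set s3 := write_mixed _ _ _.
  have es3 : holds_sizes s3 by case: es2 => -[].
  apply: (wp_for (fun a s' => Q (v * kA + a) s')%N kA
    (kB * 30 + 30)) => //.
  + by case: es3 => -[].
  + lia.
  + by rewrite addn0; split=> [|j jl] /=; rewrite /= /upd /= ?h0 // h3 // s1W.
  + move=> a s4 aK fr4 s4a [s4e s4W].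
    apply: (wp_weaken (@store_weightP s4 v a _ _ _ _ _ _)) => //.
    * exact: (holds_sizes_frame fr4).
    * move=> b; have [_ _ _ k3] := fr4; rewrite k3 //= /upd /= valK //.
    * by move=> j; rewrite s4e; apply: s4W.
    * move=> s5 [s5e s5W]; rewrite addnS; split=> // j.
      by rewrite -s5e; apply: s5W.
  + by move=> s4 _ [s4e s4W]; rewrite mulSn addnC; split.
- by move=> s1 _ [_ s1W].
Qed.

End Phases.

(** * Computing the best walks, the maximum mean and the cycle *)

Definition relax : cmd :=
  Seq (ISet ru (iadd (idiv rv rK) (imul ra rM)))
    (Seq (RSet fCand (ROp RAdd (RGet aD (iadd rbase ru))
                        (RGet aW (iadd (imul ru rK) (imod rv rK)))))
       (If (BRle fBest fCand) (Seq (RSet fBest fCand) (ISet rp ru)) Skip)).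

(* Row 0 of the table of best weights is the initial memory; starting the
   maximum at 0 is harmless because the weights are nonnegative. *)
Definition compute_best : cmd :=
  Seq (ISet rNN (imul rN rN))
    (For rt rNN
       (Seq (ISet rv (imod rt rN))
          (Seq (ISet rbase (isub rt rv))
             (Seq (RSet fBest (RCast (IConst 0)))
                (Seq (For ra rK relax)
                   (Seq (RPut aD (iadd rt rN) fBest)
                      (IPut aPred (iadd rt rN) rp))))))).

Definition update_min : cmd :=
  Seq (RSet fCand (ROp RDiv (ROp RSub (RGet aD (iadd rNN rv))
                               (RGet aD (iadd (imul ri rN) rv)))
                     (RCast (isub rN ri))))
    (If (BRle fCand fCur) (RSet fCur fCand) Skip).

Definition compute_mean : cmd :=
  Seq (RSet fLam (RCast (IConst 0)))
    (For rv rN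
       (Seq (RSet fCur (ROp RDiv (RGet aD (iadd rNN rv)) (RCast rN)))
          (Seq (For ri rN update_min)
             (If (BRle fLam fCur)
                (Seq (RSet fLam fCur) (ISet rbestv rv)) Skip)))).

Definition trace_path : cmd :=
  Seq (IPut aPath (IConst 0) rbestv)
    (For rt rN
       (IPut aPath (iadd rt (IConst 1))
          (IGet aPred (iadd (imul (isub rN rt) rN) (IGet aPath rt))))).

Definition compare_nodes : cmd :=
  If (BAnd (BIle (IGet aPath ri) (IGet aPath rj))
        (BIle (IGet aPath rj) (IGet aPath ri)))
    (Seq (ISet rbi ri) (ISet rbj rj)) Skip.

Definition find_repetition : cmd :=
  Seq (ISet rx (iadd rN (IConst 1))) (For rj rx (For ri rj compare_nodes)).

(** Register 0 must end up holding the length of the cycle, but the remainders still need [kA] from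
    it, so it is overwritten last. *)
Definition write_cycle : cmd :=
  Seq (ISet rL (isub rbj rbi))
    (Seq (For rt rL
            (IPut aOut rt
               (imod (IGet aPath (isub (isub rbj (IConst 1)) rt)) rK)))
       (ISet rK rL)).

Section CyclePhases.

Variables (R : realType) (kA kB m : nat) (uA : utility R kA kB).
Variables (f : count_rule R kA kB) (H : R).
Hypotheses (kA_gt0 : (0 < kA)%N) (kB_gt0 : (0 < kB)%N).
Hypothesis f_rule : is_rule m.+1 f.
Hypothesis uA_bound : forall a b, 0 <= uA a b <= H.

Let M := (kA ^ m)%N.
Let N := (kA * M)%N.
Let W := edge_weight m uA f.
Let D := best_walk kA M W.
Let sizes := @holds_sizes R kA kB m uA.

Let M_gt0 : (0 < M)%N. Proof. by rewrite expn_gt0 kA_gt0. Qed.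
Let N_gt0 : (0 < N)%N. Proof. by rewrite muln_gt0 kA_gt0 M_gt0. Qed.
Let W_bound v a : 0 <= W v a <= H.
Proof. exact: (edge_weight_bound kA_gt0 kB_gt0 f_rule uA_bound). Qed.

Definition best_step (n v u : nat) : Prop :=
  exists2 d, (d < kA)%N &
    u = pred_node kA M v d /\ D n v = D n.-1 u + W u (v %% kA).

Definition holds_weights (s : state R) : Prop :=
  forall j, (j < N * kA)%N -> rarr s aW j = W (j %/ kA) (j %% kA).

Definition holds_best (s : state R) : Prop :=
  (forall n v, (n <= N)%N -> (v < N)%N -> rarr s aD (n * N + v) = D n v) /\
  (forall n v, (0 < n <= N)%N -> (v < N)%N ->
     best_step n v (iarr s aPred (n * N + v))).

Lemma relaxP s n v d : sizes s -> holds_weights s ->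
  ivar s rv = v -> ivar s ra = d -> ivar s rbase = (n * N)%N ->
  (v < N)%N -> (d < kA)%N ->
  (forall u, (u < N)%N -> rarr s aD (n * N + u) = D n u) ->
  let u := pred_node kA M v d in
  let x := D n u + W u (v %% kA) in
  wp m.+1 f relax 60 (fun s' =>
    if rvar s fBest <= x
    then rvar s' fBest = x /\ ivar s' rp = u
    else rvar s' fBest = rvar s fBest /\ ivar s' rp = ivar s rp) s.
Proof.
move=> [[e0 e1 e2 eu] eN eM] eW ev ea eb vN dK eD u x.
have uN : (u < N)%N by apply: pred_node_lt.
apply: wp_run => //.
have cE : rarr s aD (n * N + u) + rarr s aW (u * kA + v %% kA) = x.
  rewrite eD // eW; last first.
    by have := ltn_pmod v kA_gt0; move: (v %% kA)%N => z; nia.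
  by rewrite divnMDl // (divn_small (ltn_pmod _ _)) // addn0 modnMDl modn_mod.
rewrite /= /upd /= ev ea eM e0 eb -/(pred_node kA M v d) -/u cE.
by case: ifP => le; rewrite le /= /upd /=.
Qed.

Lemma compute_bestP s : sizes s -> holds_weights s ->
  (forall j, rarr s aD j = 0) ->
  wp m.+1 f compute_best (N * N * (kA * 70 + 80) + 30)
    (fun s' => ivar s' rNN = (N * N)%N /\ holds_best s') s.
Proof.
move=> es eW eD0; have [[e0 e1 e2 eu] eN eM] := es.
apply: (wp_cost (4 + (N * N * (kA * 70 + 80) + 10))); first lia.
apply: wp_seq; apply: wp_run => //=.
(* One counter [t = n * N + v] sweeps the flattened table and fills the entry [t + N], one row
   further. Row 0 has no predecessors, hence the condition [N <= j]. *)
pose Inv i (s' : state R) :=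
  (forall j, (j < i + N)%N -> rarr s' aD j = D (j %/ N) (j %% N)) /\
  (forall j, (N <= j < i + N)%N ->
     best_step (j %/ N) (j %% N) (iarr s' aPred j)).
apply: (wp_for Inv (N * N) (kA * 70 + 60)) => //.
- by rewrite /= /upd /= eN.
- by rewrite leq_add // leq_mul2l; apply/orP; right; lia.
- split=> j; rewrite add0n; last by case: leqP.
  by move=> jN; rewrite divn_small //= /upd /= eD0.
- move=> t s1 tN fr s1t [s1D s1P].
  have es1 : sizes s1 by apply: (holds_sizes_frame fr).
  have [_ _ _ h3] := fr.
  have eW1 : holds_weights s1 by move=> j jN; rewrite h3 // /= eW.
  have [[k0 k1 k2 ku] kN kM] := es1.
  set n := (t %/ N)%N; set v := (t %% N)%N.
  have nN : (n < N)%N by rewrite ltn_divLR.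
  have vN : (v < N)%N by rewrite ltn_pmod.
  have tE : t = (n * N + v)%N by apply: divn_eq.
  apply: (wp_cost (4 + (4 + (3 + ((kA * 69 + 7) + 20))))); first lia.
  apply: wp_seq; apply: wp_run => //=.
  apply: wp_seq; apply: wp_run => //=.
  apply: wp_seq; apply: wp_run => //=; apply: wp_seq.
  set s2 := set_rvar _ _ _.
  have es2 : sizes s2 by case: es1 => -[].
  pose g e := D n (pred_node kA M v e) + W (pred_node kA M v e) (v %% kA).
  (* At [d = 0] the register holds the default [0] and no predecessor is known yet. Since [relax]
     compares weakly and candidates are nonnegative, the first candidate always replaces it. *)
  pose Inv2 d (s' : state R) :=
    [/\ forall e, (e < d)%N -> g e <= rvar s' fBest,
        d = 0%N -> rvar s' fBest = 0 &
        (0 < d)%N -> exists2 e, (e < kA)%N &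
          rvar s' fBest = g e /\ ivar s' rp = pred_node kA M v e].
  apply: (wp_for Inv2 kA 60) => //.
  + move=> d s3 dK fr3 s3d [I1 I2 I3].
    have es3 : sizes s3 by apply: (holds_sizes_frame fr3).
    have [l0 _ _ l3] := fr3.
    have eW3 : holds_weights s3 by move=> j jN; rewrite l3 // /= eW1.
    have s3v : ivar s3 rv = v by rewrite l0 //= /upd /= kN s1t.
    have s3b : ivar s3 rbase = (n * N)%N.
      by rewrite l0 //= /upd /= kN s1t -/v [X in (X - _)%N]tE addnK.
    have s3D u : (u < N)%N -> rarr s3 aD (n * N + u) = D n u.
      move=> uN; rewrite l3 //= s1D.
        by rewrite divnMDl // divn_small // addn0 modnMDl modn_small.
      by rewrite tE -addnA ltn_add2l (leq_trans uN) // leq_addl.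
    apply: wp_weaken (relaxP es3 eW3 s3v s3d s3b vN dK s3D) _ _ => // s4.
    rewrite -/(g d); case: leP => [le [b4 p4]|lt [b4 p4]]; split=> //=.
    * move=> e; rewrite b4 ltnS leq_eqVlt => /predU1P[->//|ed].
      exact: le_trans (I1 e ed) le.
    * by move=> _; exists d; rewrite // /upd /=.
    * by move=> e; rewrite b4 ltnS leq_eqVlt => /predU1P[->|/I1//]; apply: ltW.
    * move=> _; rewrite /upd /= b4 p4; apply: I3; rewrite lt0n.
      apply: contraTneq lt => d0.
      rewrite -leNgt I2 // addr_ge0 ?best_walk_ge0 //.
      by case/andP: (W_bound (pred_node kA M v d) (v %% kA)).
  move=> s3 fr3 [I1 _ /(_ kA_gt0)[e eK [b3 p3]]].
  have [l0 l1 _ l3] := fr3.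
  have s3t : ivar s3 rt = t by rewrite l0.
  have s3N : ivar s3 rN = N by rewrite l0.
  have Ege : g e = D n.+1 v.
    apply/le_anti/andP; split; first exact: (best_walk_ge M W n v eK).
    have [d dK DE] := best_walk_attained M kA_gt0 W_bound n v.
    by rewrite /D DE -b3; apply: (I1 d dK).
  have tNdiv : ((t + N) %/ N = n.+1)%N by rewrite divnDr // divnn N_gt0 addn1.
  have tNmod : ((t + N) %% N = v)%N by rewrite modnDr.
  apply: wp_run => //=; split=> j; rewrite /= /upd /= s3t s3N.
  + rewrite addSn ltnS leq_eqVlt => /predU1P[->|jl].
      by rewrite eqxx b3 Ege tNdiv tNmod.
    by rewrite (ltn_eqF jl) l3 //= s1D.
  + case/andP=> Nj; rewrite addSn ltnS leq_eqVlt => /predU1P[->|jl].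
      rewrite eqxx tNdiv tNmod; exists e => //; rewrite p3; split=> //.
    by rewrite (ltn_eqF jl) l1 //=; apply: s1P; rewrite Nj.
- move=> s1 fr [s1D s1P]; have [h0 _ _ _] := fr.
  split; first by rewrite h0 //= /upd /= eN.
  have lt_idx n v : (n <= N)%N -> (v < N)%N -> (n * N + v < N * N + N)%N by nia.
  split=> n v nN vN.
    rewrite s1D ?lt_idx //.
    by rewrite divnMDl // divn_small // addn0 modnMDl modn_small.
  case/andP: nN => n0 nN.
  have := s1P (n * N + v)%N; rewrite lt_idx // andbT.
  rewrite divnMDl // divn_small // addn0 modnMDl modn_small //; apply.
  by rewrite (leq_trans _ (leq_addr _ _)) // leq_pmull.
Qed.

Lemma compute_meanP s : sizes s -> ivar s rNN = (N * N)%N -> holds_best s ->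
  wp m.+1 f compute_mean (N * N * 60 + N * 60 + 30)
    (fun s' => (ivar s' rbestv < N)%N /\ exists lam : R,
      [/\ 0 <= lam, lower_mean kA M W lam (ivar s' rbestv) &
          forall v, (v < N)%N -> upper_mean kA M W lam v]) s.
Proof.
move=> es eNN [eD _].
have eN : ivar s rN = N by case: es.
apply: (wp_cost (3 + (N * (N * 60 + 60) + 20))); first
  by rewrite mulnDr mulnA; lia.
apply: wp_seq; apply: wp_run => //=.
(* [fLam] is the largest minimum so far. Minima are nonnegative, so the weak comparison makes the
   first node replace the initial [0] and sets [rbestv]. *)
pose Inv v (s' : state R) :=
  [/\ 0 <= rvar s' fLam, v = 0%N -> rvar s' fLam = 0,
      forall v', (v' < v)%N -> upper_mean kA M W (rvar s' fLam) v' &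
      (0 < v)%N -> (ivar s' rbestv < N)%N /\
        lower_mean kA M W (rvar s' fLam) (ivar s' rbestv)].
apply: (wp_for Inv N (N * 60 + 45)) => //.
- nia.
- move=> v s1 vN fr s1v [I1 I2 I3 I4].
  have [h0 _ h2 h3] := fr.
  have s1N : ivar s1 rN = N by rewrite h0.
  have s1D n : (n <= N)%N -> rarr s1 aD (n * N + v) = D n v.
    by move=> nN; rewrite h3 //= eD.
  have s1NN : ivar s1 rNN = (N * N)%N by rewrite h0.
  apply: (wp_cost (10 + ((N * 55 + 7) + 10))); first lia.
  apply: wp_seq; apply: wp_run => //=; apply: wp_seq.
  rewrite s1NN s1N s1v s1D //; set s2 := set_rvar _ _ _.
  pose Inv2 i (s' : state R) :=
    [/\ 0 <= rvar s' fCur,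
        forall k, (k < i)%N -> rvar s' fCur * (N - k)%:R <= D N v - D k v &
        upper_mean kA M W (rvar s' fCur) v].
  apply: (wp_for Inv2 N 40) => //.
  + lia.
  + split=> //=; rewrite /upd /=.
      by rewrite divr_ge0 // best_walk_ge0.
    (* [fCur] starts as the quotient for [k = 0], because [D 0 v = 0]. *)
    by exists 0%N; rewrite // subr0 subn0 divfK // pnatr_eq0 -lt0n.
  + move=> i s3 iN fr3 s3i [J1 J2 J3].
    have [l0 _ _ l3] := fr3.
    have s3N : ivar s3 rN = N by rewrite l0.
    have s3NN : ivar s3 rNN = (N * N)%N by rewrite l0.
    have s3v : ivar s3 rv = v by rewrite l0.
    have s3D n : (n <= N)%N -> rarr s3 aD (n * N + v) = D n v.
      by move=> nN; rewrite l3 //= s1D.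
    have Ni0 : 0 < (N - i)%:R :> R by rewrite ltr0n subn_gt0.
    apply: wp_run => //=.
    rewrite /= /upd /= s3i s3N s3NN s3v !s3D //; last exact: ltnW.
    set c := (_ / _); have cE : c * (N - i)%:R = D N v - D i v.
      by rewrite divfK // gt_eqF.
    case: ifP => [le|/negbT]; last rewrite -ltNge => lt;
      split=> //=; rewrite /upd /= ?eqxx.
    * rewrite -(pmulr_lge0 _ Ni0) cE subr_ge0.
      by apply: (best_walk_homo M kA_gt0 W_bound); apply: ltnW.
    * move=> k; rewrite ltnS leq_eqVlt => /predU1P[->|ki]; first by rewrite cE.
      by apply: le_trans (J2 k ki); rewrite ler_wpM2r.
    * by exists i => //; rewrite cE.
    * move=> k; rewrite ltnS leq_eqVlt => /predU1P[->|ki]; last exact: J2.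
      by rewrite -cE ler_wpM2r ?ltW.
  move=> s3 fr3 [J1 J2 J3].
  have [l0 _ l2 _] := fr3.
  have s3L : rvar s3 fLam = rvar s1 fLam by rewrite l2.
  have s3v : ivar s3 rv = v by rewrite l0.
  have upper_le l l' v' : l <= l' -> upper_mean kA M W l v' ->
      upper_mean kA M W l' v'.
    move=> ll [k kN le]; exists k => //.
    by apply: le_trans le _; rewrite ler_wpM2r.
  apply: wp_run => //=; rewrite s3L s3v.
  case: ifP => [le|/negbT]; last rewrite -ltNge => lt;
    split=> //=; rewrite /upd /= ?eqxx ?s3L //.
  + move=> v'; rewrite ltnS leq_eqVlt => /predU1P[->//|v'v].
    exact: upper_le le (I3 v' v'v).
  + move=> v'; rewrite ltnS leq_eqVlt => /predU1P[->|/I3//].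
    exact: upper_le (ltW lt) J3.
  + move=> _; rewrite l0 //= ?/upd /=; apply: I4; rewrite lt0n.
    by apply: contraTneq lt => v0; rewrite -leNgt I2.
- move=> s1 _ [I1 _ I3 /(_ N_gt0)[I4 I5]]; split=> //.
  by exists (rvar s1 fLam); split.
Qed.

Lemma trace_pathP s : sizes s -> holds_best s -> (ivar s rbestv < N)%N ->
  wp m.+1 f trace_path (N * 40 + 30)
    (fun s' => iarr s' aPath 0 = ivar s rbestv /\
       back_path kA M W (iarr s' aPath)) s.
Proof.
move=> es [_ eP] eb; have eN : ivar s rN = N by case: es.
apply: (wp_cost (3 + (N * 40 + 20))); first lia.
apply: wp_seq; apply: wp_run => //=.
pose Inv i (s' : state R) :=
  [/\ iarr s' aPath 0 = ivar s rbestv,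
      forall k, (k <= i)%N -> (iarr s' aPath k < N)%N &
      forall k, (k < i)%N ->
        best_step (N - k) (iarr s' aPath k) (iarr s' aPath k.+1)].
apply: (wp_for Inv N 30) => //.
- lia.
- by split=> //= k; rewrite leqn0 => /eqP->; rewrite /upd.
- move=> i s1 iN [h0 h1 _ _] s1i [I1 I2 I3].
  have s1N : ivar s1 rN = N by rewrite h0.
  have step : best_step (N - i) (iarr s1 aPath i)
      (iarr s1 aPred ((N - i) * N + iarr s1 aPath i)).
    by rewrite (h1 aPred) //; apply: eP; rewrite ?I2 // subn_gt0 iN leq_subr.
  apply: wp_run => //=; rewrite s1i s1N addn1.
  split=> //= k; rewrite /upd /=.
  + case: eqP => [_ _|kn ki]; last by apply: I2; lia.
    by have [d dK [-> _]] := step; apply: pred_node_lt; rewrite ?I2.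
  + rewrite ltnS eqSS leq_eqVlt => /predU1P[->|ki].
      by rewrite eqxx (ltn_eqF (ltnSn i)).
    by rewrite (ltn_eqF ki) (ltn_eqF (ltnW ki : (k < i.+1)%N)); apply: I3.
- move=> s1 _ [I1 I2 I3]; split=> // k kN.
  by have [d dK [dE DE]] := I3 k kN; exists d => //; split=> //; rewrite subnS.
Qed.

Lemma find_repetitionP s : sizes s ->
  (forall k, (k <= N)%N -> (iarr s aPath k < N)%N) ->
  wp m.+1 f find_repetition (N * N * 200 + N * 200 + 200)
    (fun s' => (ivar s' rbi < ivar s' rbj <= N)%N /\
       iarr s aPath (ivar s' rbi) = iarr s aPath (ivar s' rbj)) s.
Proof.
move=> es qN; have eN : ivar s rN = N by case: es.
apply: (wp_cost (4 + (N.+1 * (N.+1 * 35 + 50) + 20))); first nia.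
apply: wp_seq; apply: wp_run => //=.
set q := iarr s aPath.
pose good (s' : state R) := (ivar s' rbi < ivar s' rbj <= N)%N /\
  q (ivar s' rbi) = q (ivar s' rbj).
(* Either a repetition is recorded, or the first [j] nodes are distinct. A later repetition may
   overwrite an earlier one, since any of them will do. *)
pose Inv j (s' : state R) :=
  good s' \/ forall j' i', (i' < j')%N -> (j' < j)%N -> q i' <> q j'.
apply: (wp_for Inv N.+1 (N.+1 * 35 + 20)) => //.
- by rewrite /= /upd /= eN addn1.
- nia.
- by right.
- move=> j s1 jN [h0 h1 _ _] s1j I.
  have s1q : iarr s1 aPath = q by rewrite h1.
  pose Inv2 i (s' : state R) := good s' \/
    (forall j' i', (i' < j')%N -> (j' < j)%N -> q i' <> q j') /\
    (forall i', (i' < i)%N -> q i' <> q j).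
  apply: (wp_for Inv2 j 25) => //.
  + nia.
  + by case: I => [g|I]; [left | right].
  + move=> i s2 ij [k0 k1 _ _] s2i I2.
    have s2q : iarr s2 aPath = q by rewrite k1.
    have s2j : ivar s2 rj = j by rewrite k0.
    apply: wp_run => //=; rewrite s2q s2i s2j -eqn_leq.
    case: eqP => [qij|qij].
      by left; rewrite /good /= /upd /= s2j ij qij -ltnS jN.
    case: I2 => [g|[I2 I3]]; [by left | right; split=> // i'].
    by rewrite ltnS leq_eqVlt => /predU1P[->|/I3].
  + move=> s2 _ [g|[I2 I3]]; [by left | right => j' i' ij'].
    rewrite ltnS leq_eqVlt => /predU1P[j'j|]; last exact: I2.
    by rewrite j'j; apply: I3; rewrite -j'j.
- move=> s1 _ [//|inj].
  (* Pigeonhole: otherwise [q 0], ..., [q N] would be [N.+1] distinct numbers below [N]. *)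
  suff : (N.+1 <= N)%N by rewrite ltnn.
  rewrite -[X in (X <= _)%N](size_mkseq q) -[X in (_ <= X)%N](size_iota 0).
  apply: uniq_leq_size => [|x /mapP[k]].
    apply/mkseq_uniqP => i j iN jN qij.
    have [ij|ij|//] := ltngtP i j; first by case: (inj j i ij jN).
    by case: (inj i j ij iN).
  by rewrite !mem_iota /= !add0n ltnS => kN ->; apply: qN.
Qed.

Lemma write_cycleP s i j : ivar s rK = kA -> ivar s rbi = i -> ivar s rbj = j ->
  (i <= j <= N)%N ->
  wp m.+1 f write_cycle (N * 40 + 40)
    (fun s' => output s' = path_actions kA (iarr s aPath) i j) s.
Proof.
move=> e0 ei ej /andP[ij jN].
apply: (wp_cost (4 + ((N * 35 + 20) + 5))); first lia.
apply: wp_seq; apply: wp_run => //=; apply: wp_seq.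
apply: (wp_for (fun n s' => forall t, (t < n)%N ->
  iarr s' aOut t = iarr s aPath (j.-1 - t) %% kA)%N (j - i)%N 20) => //.
- by rewrite /= /upd /= ei ej.
- nia.
- move=> n s1 nij [h0 h1 _ _] s1t I; apply: wp_run => //= t.
  rewrite /= /upd /= s1t ltnS leq_eqVlt => /predU1P[->|tn].
    by rewrite eqxx h1 // (h0 rbj) // (h0 rK) //= /upd /= ej e0 subn1.
  by rewrite (ltn_eqF tn); apply: I.
- move=> s1 [h0 h1 _ _] I; apply: wp_run => //=.
  rewrite /output /path_actions /= /upd /= h0 //= /upd /= ei ej.
  apply/eq_in_map => t; rewrite mem_iota /= add0n => tl.
  exact: I.
Qed.

End CyclePhases.

(** * The whole program and its guarantee *)

Definition karp : cmd :=
  Seq count_nodes (Seq compute_weights (Seq compute_best (Seq compute_mean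
    (Seq trace_path (Seq find_repetition write_cycle))))).

Section Karp.

Variables (R : realType) (kA kB m T : nat) (uA uB : utility R kA kB).
Variables (f : count_rule R kA kB) (H : R).
Hypotheses (kA_gt0 : (0 < kA)%N) (kB_gt0 : (0 < kB)%N).
Hypothesis f_rule : is_rule m.+1 f.
Hypothesis uA_bound : forall a b, 0 <= uA a b <= H.

Let M := (kA ^ m)%N.
Let N := (kA * M)%N.
Let W := edge_weight m uA f.

Let M_gt0 : (0 < M)%N. Proof. by rewrite expn_gt0 kA_gt0. Qed.
Let N_gt0 : (0 < N)%N. Proof. by rewrite muln_gt0 kA_gt0 M_gt0. Qed.
Let W_bound v a : 0 <= W v a <= H.
Proof. exact: (edge_weight_bound kA_gt0 kB_gt0 f_rule uA_bound). Qed.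

(** The term [N * N * kA] pays for the table of best walks, with [kA] candidates for each entry, and
    [N * (m.+1 + kA * kB)] for the weights, with one query per node. Lower-order terms are absorbed
    by the constant. *)
Lemma karpP : wp m.+1 f karp
  (1000 * (N * N * kA + N * (m.+1 + kA * kB)))
  (fun s => exists q i j (lam : R),
     [/\ (q 0 < N)%N, back_path kA M W q, (i < j <= N)%N, q i = q j &
       [/\ output s = path_actions kA q i j, 0 <= lam,
           lower_mean kA M W lam (q 0) &
           forall v, (v < N)%N -> upper_mean kA M W lam v]])
  (init_state uA uB m.+1 T).
Proof.
have NK : (N * N <= N * N * kA)%N by rewrite leq_pmulr.
have NN : (N <= N * N)%N by rewrite leq_pmulr.
have Nm : (m.+1 <= N * m.+1)%N by rewrite leq_pmull.
apply: (wp_cost ((m.+1 * 15 + 30) +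
  ((N * (kA * kB * 100 + m.+1 * 40 + 120) + 30) +
  ((N * N * (kA * 70 + 80) + 30) + ((N * N * 60 + N * 60 + 30) +
  ((N * 40 + 30) + ((N * N * 200 + N * 200 + 200) + (N * 40 + 40))))))));
  first by rewrite !mulnDr; lia.
apply: wp_seq; apply: wp_frame.
have es0 : holds_input m uA (init_state uA uB m.+1 T) by [].
apply: wp_weaken (count_nodesP f kA_gt0 kB_gt0 es0) _ _ => // s1 es1 [_ _ _ h3].
have s1D j : rarr s1 aD j = 0 by rewrite h3.
apply: wp_seq; apply: wp_frame.
apply: wp_weaken (compute_weightsP f kA_gt0 kB_gt0 es1) _ _ => // s2 s2W fr2.
have es2 := holds_sizes_frame fr2 isT isT es1.
have s2D j : rarr s2 aD j = 0 by have [_ _ _ ->] := fr2.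
apply: wp_seq; apply: wp_frame.
apply: wp_weaken
  (compute_bestP kA_gt0 kB_gt0 f_rule uA_bound es2 s2W s2D) _ _ => //.
move=> s3 [s3NN s3D] fr3.
have es3 := holds_sizes_frame fr3 isT isT es2.
apply: wp_seq; apply: wp_frame.
apply: wp_weaken
  (compute_meanP kA_gt0 kB_gt0 f_rule uA_bound es3 s3NN s3D) _ _ => //.
move=> s4 [vN [lam [lam0 low up]]] fr4.
have es4 := holds_sizes_frame fr4 isT isT es3.
have s4D : holds_best m uA f s4.
  have [_ k1 _ k3] := fr4; case: s3D => d p; split=> n v.
    by rewrite k3 //; apply: d.
  by rewrite k1 //; apply: p.
apply: wp_seq; apply: wp_frame.
apply: wp_weaken (trace_pathP kA_gt0 kB_gt0 es4 s4D vN) _ _ => //.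
move=> s5 [q0 qP] fr5.
have es5 := holds_sizes_frame fr5 isT isT es4.
have q0N : (iarr s5 aPath 0 < N)%N by rewrite q0.
have qN k : (k <= N)%N -> (iarr s5 aPath k < N)%N by apply: back_path_lt qP _.
apply: wp_seq; apply: wp_frame.
apply: wp_weaken (find_repetitionP f kA_gt0 kB_gt0 es5 qN) _ _ => //.
move=> s6 [ij qij] fr6.
have es6 := holds_sizes_frame fr6 isT isT es5.
have [_ k1 _ _] := fr6.
have s6K : ivar s6 rK = kA by case: es6 => -[].
have ij' : (ivar s6 rbi <= ivar s6 rbj <= N)%N.
  by case/andP: ij => /ltnW -> ->.
apply: wp_weaken (write_cycleP f kA_gt0 kB_gt0 s6K erefl erefl ij') _ _ => //.
move=> s7 out.
exists (iarr s5 aPath), (ivar s6 rbi), (ivar s6 rbj), lam; split=> //.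
by split=> //; rewrite ?q0 // out k1.
Qed.

Lemma map_val_repeat_cycle L (c : L.+1.-tuple 'I_kA) :
  map val (repeat_cycle c T) = periodic (map val c) T.
Proof.
rewrite /periodic /mkseq -(val_enum_ord T) -!map_comp.
apply: eq_map => t /=; rewrite size_map size_tuple.
rewrite (nth_map (tnth c ord0)) ?size_tuple ?ltn_pmod //.
by rewrite (tnth_nth (tnth c ord0)) inordK ?ltn_pmod.
Qed.

(** The loss is at most [N * H] four times: passing from play to walk for the optimum and for the
    cycle, the excess of a walk over [T * lam], and the unfinished turn of the cycle. Both walks
    start at [q j], where the cycle closes. *)
Lemma opt_repeat_cycle q i j lam L (c : L.+1.-tuple 'I_kA) :
  (q 0 < N)%N -> back_path kA M W q -> (i < j <= N)%N -> q i = q j ->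
  0 <= lam -> lower_mean kA M W lam (q 0) ->
  (forall v, (v < N)%N -> upper_mean kA M W lam v) ->
  map val c = path_actions kA q i j ->
  opt uA m.+1 f T - 4%:R * N%:R * H <= payoff uA m.+1 f (repeat_cycle c T).
Proof.
move=> q0 qP ij qij lam0 low up cE.
have H0 : 0 <= H by case/andP: (W_bound 0 0) => h1 h2; apply: le_trans h1 h2.
have [[x <-] _] := opt_max uA m.+1 f T kA_gt0.
(* For [kA = 1] one has [N = 1], which need not dominate [m.+1]; but then all plays coincide. *)
have [kA1|kA2] := leqP kA 1.
  have -> : x = repeat_cycle c T.
    apply: eq_from_tnth => t; apply: val_inj.
    have := ltn_ord (tnth x t); have := ltn_ord (tnth (repeat_cycle c T) t).
    by move=> /= h1 h2; lia.
  by rewrite gerBl !mulr_ge0.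
have mN : m.+1%:R * H <= N%:R * H.
  rewrite ler_wpM2r // ler_nat /N /M -expnS; exact/ltnW/ltn_expl.
have [ij1 jN] := andP ij.
have qjN : (q j < N)%N by apply: back_path_lt qP _ jN.
have xW := payoff_walk kA_gt0 kB_gt0 f_rule uA_bound (q j) x.
have cW := payoff_walk kA_gt0 kB_gt0 f_rule uA_bound (q j) (repeat_cycle c T).
have up_x :=
  walk_weight_upper kA_gt0 M_gt0 W_bound lam0 up qjN (s := map val x).
rewrite size_map size_tuple in up_x.
have {}up_x := up_x ltac:(by apply/allP => _ /mapP[a _ ->] /=).
have low_c : T%:R * lam - N%:R * H <=
    walk_weight kA M W (q j) (map val (repeat_cycle c T)).
  rewrite map_val_repeat_cycle cE.
  apply: (periodic_lower kA_gt0 M_gt0 W_bound).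
  - by rewrite lam0 (lower_mean_le kA_gt0 M_gt0 W_bound low).
  - by rewrite size_mkseq; lia.
  - rewrite -[RHS]qij; apply: (foldl_path_actions kA_gt0 M_gt0 q0 qP).
    by rewrite ltnW.
  - exact: cycle_mean_ge.
move: xW cW; rewrite !ler_norml => /andP[_ h1] /andP[h2 _].
rewrite -/M -/W in h1 h2; rewrite -/N in up_x; lra.
Qed.

End Karp.

Theorem theorem6 :
  exists (P : cmd) (C1 C2 : nat),
    forall (R : realType) (kA kB m T : nat) (uA uB : utility R kA kB)
           (f : count_rule R kA kB) (H : R),
      (0 < kA)%N -> (0 < kB)%N -> (1 <= m)%N ->
      is_rule m f ->
      (forall a b, 0 <= uA a b <= H) ->
      exists (t L : nat) (s : state R) (c : L.+1.-tuple 'I_kA),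
        [/\ exec m f P (init_state uA uB m T) t s,
            output s = [seq val a | a <- c],
            (t <= C2 * (kA ^ (2 * m + 1) + kA ^ m * (m + kA * kB)))%N &
            opt uA m f T - C1%:R * (kA ^ m)%:R * H
              <= payoff uA m f (repeat_cycle c T)].
Proof.
exists karp, 4%N, 1000%N => R kA kB [//|m] T uA uB f H kA0 kB0 _ fP uP.
have [t [s [e tle [q [i [j [lam [q0 qP ij qij [out lam0 low up]]]]]]]]] :=
  karpP T uB kA0 kB0 fP uP.
(* The default of [insubd] never occurs, as labels are digits below [kA]. *)
pose acts := [seq insubd (Ordinal kA0) a | a <- path_actions kA q i j].
have acts_val : map val acts = path_actions kA q i j.
  rewrite -map_comp -[RHS]map_id; apply/eq_in_map => a /=.
  by move/(allP (all_path_actions kA0 q i j)) => /= aK; rewrite val_insubd aK.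
have size_acts : size acts == (j - i).-1.+1.
  by rewrite size_map size_mkseq prednK // subn_gt0; case/andP: ij.
exists t, (j - i).-1, s, (Tuple size_acts); split=> //.
- by rewrite out.
(* With [N] equal to [kA] to the power of the memory length, the first term of the bound is
   [N * N * kA]. *)
- rewrite addn1 expnS mul2n -addnn expnD.
  by rewrite mulnC -expnS in tle; rewrite [(kA * _)%N]mulnC; rewrite mulnC.
- rewrite expnS; exact: (opt_repeat_cycle T (c := Tuple size_acts)
    kA0 kB0 fP uP q0 qP ij qij lam0 low up acts_val).
Qed.
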